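(* For every integer $n \geq 3$ there exists a set of $n$-sided dice $(A,B,C)$ that is both balanced and non-transitive.
   Context: Fix an integer $n>0$ and write $[N]=\{1,\dots,N\}$. A set of $n$-sided dice is an ordered triple $(A,B,C)$ of pairwise disjoint sets with $|A|=|B|=|C|=n$ and $A\cup B\cup C=[3n]$; each die is fair, showing each of its $n$ labels with probability $1/n$, and dice are rolled independently. For dice $X,Y$, $P(X\succ Y)$ denotes the probability that the number rolled on $X$ exceeds the number rolled on $Y$, i.e. $P(X\succ Y)=\frac{1}{n^2}|\{(x,y)\in X\times Y: x>y\}|$. The set of dice is non-transitive if each of $P(A\succ B)$, $P(B\succ C)$, $P(C\succ A)$ exceeds $1/2$, and balanced if $P(A\succ B)=P(B\succ C)=P(C\succ A)$. *)

(* Defs.v *)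
From mathcomp Require Import all_boot all_order all_algebra.
From mathcomp Require Import finmap.

Set Implicit Arguments.
Unset Strict Implicit.
Unset Printing Implicit Defensive.

Import Order.TTheory GRing.Theory Num.Theory.

Local Open Scope fset_scope.
Local Open Scope ring_scope.

(* [fset k in iota 1 (3 * n)] is [3n] = {1, ..., 3n}: iota takes a length. *)
Definition dice_set (n : nat) (A B C : {fset nat}) : Prop :=
  [/\ [disjoint A & B], [disjoint B & C] & [disjoint C & A]]
  /\ [/\ #|` A| = n, #|` B| = n & #|` C| = n]
  /\ A `|` B `|` C = [fset k in iota 1 (3 * n)].

(* P(X > Y) for independent uniform rolls on two n-sided dice X and Y. *)
Definition win_prob (n : nat) (X Y : {fset nat}) : rat :=
  #|` [fset p in X `*` Y | (p.2 < p.1)%N]|%:R / n%:R ^+ 2.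

Definition non_transitive (n : nat) (A B C : {fset nat}) : Prop :=
  [/\ 1 / 2 < win_prob n A B, 1 / 2 < win_prob n B C
    & 1 / 2 < win_prob n C A].

Definition balanced (n : nat) (A B C : {fset nat}) : Prop :=
  win_prob n A B = win_prob n B C /\ win_prob n B C = win_prob n C A.

(* Main.v *)
(** Giving six new top faces to the dice in the order [ABCCBA] leaves the
    excess [2 * #wins - n ^ 2] of each of the three pairs unchanged: a pair
    gains [2 * n] wins of new against old faces and [2] wins among the new
    ones, while [n ^ 2] grows by [4 * n + 4]. So balanced non-transitive dice
    with [n] faces give such dice with [n + 2] faces, and explicit dice with
    3 and 4 faces are enough. *)

Require Import Defs.
From mathcomp Require Import all_boot all_order all_algebra.
From mathcomp Require Import finmap.
From mathcomp Require Import zify.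

Set Implicit Arguments.
Unset Strict Implicit.
Unset Printing Implicit Defensive.

Definition wins (s t : seq nat) : nat := \sum_(x <- s) count (ltn^~ x) t.

(** Dice as lists, with the denominator [n ^ 2] cleared: small cases are settled by computation, and
    new faces are simply consed on. *)
Definition dice_seqs (n : nat) (a b c : seq nat) : Prop :=
  [/\ perm_eq (a ++ b ++ c) (iota 1 (3 * n)),
      [/\ size a = n, size b = n & size c = n],
      wins a b = wins b c, wins b c = wins c a & n ^ 2 < 2 * wins a b].

(** Each of [p] and [q] beats all of [s2], while no face in [s1] beats [r] or [t]; what remains is
    the four comparisons among new faces. *)
Lemma wins_add2_top (m p q r t : nat) (s1 s2 : seq nat) :
    {in s1, forall x, x <= m} -> {in s2, forall x, x <= m} ->
    m < p -> m < q -> m < r -> m < t ->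
  wins [:: p, q & s1] [:: r, t & s2] =
    wins s1 s2 + 2 * size s2 + ((r < p) + (t < p) + (r < q) + (t < q)).
Proof.
move=> s1m s2m mp mq mr mt.
have top x : m < x -> count (ltn^~ x) s2 = size s2.
  by move=> mx; apply/eqP; rewrite -all_count; apply/allP => y /s2m /=; lia.
have old : \sum_(x <- s1) count (ltn^~ x) [:: r, t & s2] = wins s1 s2.
  by apply: eq_big_seq => x /s1m /= xm; rewrite !ltnNge !(leq_trans xm) 1?ltnW.
by rewrite [LHS]big_cons big_cons old /= !top //; lia.
Qed.

Lemma dice_seqs_add2 (n : nat) (a b c : seq nat) :
  dice_seqs n a b c -> exists a' b' c', dice_seqs n.+2 a' b' c'.
Proof.
move=> [abc [sa sb sc] eab ebc gt].
have bound x : x \in a ++ b ++ c -> x <= 3 * n.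
  by rewrite (perm_mem abc) mem_iota; lia.
have am : {in a, forall x, x <= 3 * n}.
  by move=> x xa; apply: bound; rewrite mem_cat xa.
have bm : {in b, forall x, x <= 3 * n}.
  by move=> x xb; apply: bound; rewrite !mem_cat xb orbT.
have cm : {in c, forall x, x <= 3 * n}.
  by move=> x xc; apply: bound; rewrite !mem_cat xc !orbT.
set m := 3 * n in am bm cm.
exists [:: m + 1, m + 6 & a], [:: m + 2, m + 5 & b], [:: m + 3, m + 4 & c].
split.
(* Counting an arbitrary predicate turns the reordering of the faces into linear arithmetic. *)
- apply/permP => P; have -> : 3 * n.+2 = m + 6 by lia.
  move/permP/(_ P): abc; rewrite (iotaD 1 m 6) !count_cat /= -/m.
  by rewrite !addnS !addn0 !add1n; lia.
- by rewrite /= sa sb sc.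
- by rewrite !(@wins_add2_top m) //; lia.
- by rewrite !(@wins_add2_top m) //; lia.
- by rewrite !(@wins_add2_top m) //; lia.
Qed.

Lemma dice_seqs_exist (n : nat) :
  3 <= n -> exists a b c, dice_seqs n a b c.
Proof.
(* Faces are added two at a time, so the induction carries two consecutive sizes. *)
suff H k : (exists a b c, dice_seqs (3 + k) a b c) /\
           (exists a b c, dice_seqs (4 + k) a b c).
  by move=> n3; have [+ _] := H (n - 3); rewrite subnKC.
elim: k => [|k [[a [b [c g3]]] g4]].
  split.
    (* Each die beats the next in 5 of 9 rolls here, and in 9 of 16 for the four-sided dice. *)
    by exists [:: 1; 5; 9], [:: 3; 4; 8], [:: 2; 6; 7];
      rewrite /dice_seqs /wins unlock.
  by exists [:: 1; 6; 8; 11], [:: 4; 5; 7; 10], [:: 2; 3; 9; 12];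
    rewrite /dice_seqs /wins unlock.
split; first exact: g4.
exact: dice_seqs_add2 g3.
Qed.

Import GRing.Theory Num.Theory.
Local Open Scope fset_scope.

(** Without repeated faces the list of winning pairs has no duplicates, so its size, summed over the
    rolls in [s], is the cardinality. *)
Lemma card_wins (s t : seq nat) : uniq s -> uniq t ->
  #|` [fset p in [fset x in s] `*` [fset y in t] | (p.2 < p.1)]| = wins s t.
Proof.
move=> us ut.
pose r := [seq p <- [seq (x, y) | x <- s, y <- t] | p.2 < p.1].
have -> : [fset p in [fset x in s] `*` [fset y in t] | p.2 < p.1] =
          [fset p in r].
  apply/fsetP => -[x y]; rewrite !inE /= mem_filter andbC /=.
  congr andb; apply/andP/allpairsP => [[xs yt]|[[x' y'] [/= xs yt [-> ->]]]] //.
  by exists (x, y).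
rewrite card_imfset //= undup_id; last first.
  by rewrite filter_uniq // allpairs_uniq // => -[? ?] [? ?].
rewrite size_filter count_flatten sumnE !big_map.
by apply: eq_bigr => x _; rewrite count_map.
Qed.

Theorem theorem2p1 (n : nat) (hn : 3 <= n) :
  exists A B C : {fset nat},
    dice_set n A B C /\ balanced n A B C /\ non_transitive n A B C.
Proof.
have [a [b [c [abc [sa sb sc] eab ebc gt]]]] := dice_seqs_exist hn.
have : uniq (a ++ b ++ c) by rewrite (perm_uniq abc) iota_uniq.
rewrite !cat_uniq has_cat negb_or => /and3P[ua /andP[dab dac]].
move=> /and3P[ub dbc uc].
have disj (s t : seq nat) : ~~ has (mem s) t ->
    [disjoint [fset x in s] & [fset x in t]].
  move=> /hasPn st; apply/fdisjointP => x; rewrite !inE => xs.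
  by apply/negP => /st; rewrite inE xs.
have win s t : uniq s -> uniq t ->
    win_prob n [fset x in s] [fset x in t] = ((wins s t)%:R / n%:R ^+ 2)%R.
  by move=> us ut; rewrite /win_prob card_wins.
have half k : n ^ 2 < 2 * k -> (1 / 2 < k%:R / n%:R ^+ 2 :> rat)%R.
  move=> nk; rewrite ltr_pdivlMr; last by rewrite exprn_gt0 // ltr0n; lia.
  by rewrite mulrAC mul1r ltr_pdivrMr // -natrX -natrM ltr_nat mulnC.
exists [fset x in a], [fset x in b], [fset x in c]; split; last first.
  (* All three probabilities become the fraction with numerator [wins a b], so balance is
     immediate. *)
  rewrite /balanced /non_transitive !win // -!ebc -!eab.
  by split=> //; split; apply: half.
split; last split.
- by split; last rewrite fdisjoint_sym; apply: disj.
- by rewrite !card_fseq !undup_id.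
- by apply/fsetP => x; rewrite !inE /= -(perm_mem abc) !mem_cat orbA.
Qed.
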